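(* Let $A\in\mathbb{R}^{n\times n}$ be symmetric positive semidefinite with eigendecomposition $A=V\Lambda V^\top=\lambda_* v_* v_*^\top+V_2\Lambda_2V_2^\top$, where $V=[v_*,V_2]$ is orthogonal, $\lambda_*=\lambda_1$ is the largest eigenvalue of $A$, $\Lambda_2=\mathrm{diag}(\lambda_2,\dots,\lambda_n)$ with $\lambda_2>\lambda_3>\cdots>\lambda_n$, and $\lambda_1>\lambda_2$. Let $\eta>0$ and let $\hat A\in\mathbb{R}^{n\times n}$ be a symmetric matrix that shares the same column space with $A$ and satisfies $A-3\eta I\preceq\hat A\preceq A-\eta I$. Then the EPSI iteration $$u_{k+1}=\frac{(\hat A-\lambda(u_k)I)^{-1}(\hat A-A)u_k}{\|(\hat A-\lambda(u_k)I)^{-1}(\hat A-A)u_k\|},\qquad \lambda(u)=\frac{u^\top Au}{u^\top u},$$ yields a (normalized) sequence $\{u_k\}$ which converges to $v_*$ with a linear-quadratic behavior. Suppose that $u_k$ satisfies $\frac{\|V_2^\top u_k\|}{\|u_k\|}\le\epsilon$ with $\frac{\lambda_1}{\eta}\epsilon<1$; then the convergence of $u_{k+1}$ is guaranteed by $$\|V_2^\top u_{k+1}\|\le\frac{3\lambda_1}{\lambda_1-\lambda_2}\cdot\frac{\eta}{\lambda_1}\cdot\frac{1}{1-\frac{\lambda_1}{\eta}\epsilon}\,\|V_2^\top u_k\|+\frac{2\lambda_1}{\eta}\|V_2^\top u_k\|^2 .$$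
   Context: $\preceq$ denotes the Loewner order on real symmetric matrices ($X\preceq Y$ iff $Y-X$ is positive semidefinite). $\|\cdot\|$ is the Euclidean norm for vectors. EPSI stands for ''Error-Powered Sketched Inverse Iteration'', the iteration displayed in the claim; $\lambda(u)$ is the Rayleigh quotient of $A$ at $u$.
   Formalization: Convergence to v_* is proved locally: for unit u_0 with ||V_2^T u_0|| below some delta>0, with limit sign(v_*^T u_0) v_*. From an arbitrary start the claim fails: u_0 = v_2 is a fixed point, and u_0 = -v_* stays at -v_*. *)

(* Defs.v *)
From HB Require Import structures.
From mathcomp Require Import all_boot all_order all_algebra.
From mathcomp Require Import all_classical all_reals all_analysis.

Set Implicit Arguments.
Unset Strict Implicit.
Unset Printing Implicit Defensive.

Import Order.TTheory GRing.Theory Num.Theory.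
Import numFieldNormedType.Exports.

Local Open Scope ring_scope.

(* The norm `|x| that MathComp-Analysis puts on matrices is the sup norm. *)
Definition enorm (R : realType) (m : nat) (x : 'cV[R]_m) : R :=
  Num.sqrt (\sum_i x i 0 ^+ 2).

Definition psd (R : realType) (m : nat) (X : 'M[R]_m) : Prop :=
  X^T = X /\ forall x : 'cV[R]_m, 0 <= (x^T *m X *m x) 0 0.

Definition loewner_le (R : realType) (m : nat) (X Y : 'M[R]_m) : Prop :=
  psd (Y - X).

(* The rows of X^T are the columns of X. *)
Definition same_column_space (R : realType) (m : nat) (X Y : 'M[R]_m) : Prop :=
  (X^T :=: Y^T)%MS.

Definition rayleigh (R : realType) (m : nat) (A : 'M[R]_m) (u : 'cV[R]_m) : R :=
  (u^T *m A *m u) 0 0 / (u^T *m u) 0 0.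

Definition shifted (R : realType) (m : nat) (A Ahat : 'M[R]_m) (u : 'cV[R]_m) :
    'M[R]_m :=
  Ahat - (rayleigh A u)%:M.

Definition epsi_dir (R : realType) (m : nat) (A Ahat : 'M[R]_m) (u : 'cV[R]_m) :
    'cV[R]_m :=
  invmx (shifted A Ahat u) *m ((Ahat - A) *m u).

(* invmx and division are total; this says that they are used on an invertible
   matrix and a nonzero norm. *)
Definition epsi_well_defined (R : realType) (m : nat) (A Ahat : 'M[R]_m)
    (u : 'cV[R]_m) : Prop :=
  shifted A Ahat u \in unitmx /\ enorm (epsi_dir A Ahat u) != 0.

Definition epsi_step (R : realType) (m : nat) (A Ahat : 'M[R]_m)
    (u : 'cV[R]_m) : 'cV[R]_m :=
  (enorm (epsi_dir A Ahat u))^-1 *: epsi_dir A Ahat u.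

Definition epsi_sequence (R : realType) (m : nat) (A Ahat : 'M[R]_m)
    (u : nat -> 'cV[R]_m) : Prop :=
  forall k, u k.+1 = epsi_step A Ahat (u k).

(* Main.v *)
(* Put E = A - Ahat, so eta I <= E <= 3 eta I, and let mu = lambda_1 - lambda(u),
   which lies in [0, lambda_1 s^2] where s is the norm of the component of u
   orthogonal to v.  The unnormalized iterate w solves
   (lambda(u) I - A) w = E (u - w).  Testing this equation against v and against
   the tail z of w (its component orthogonal to v), and eliminating the
   v-component, leaves an energy inequality for z in terms of the Schur
   complement S of E with respect to v:
     (lambda_1 - lambda_2 - mu) |z|^2 + S(z, z) <= S(z, u) + mu |v.w| |z|.
   Since eta <= S <= 3 eta on the complement of v, this bounds |z|.  In the norm
   of S it is a contraction up to quadratic terms whatever the size of eta, hence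
   local convergence.  For the stated rate |w| must be bounded below by 1 - q,
   q = lambda_1 s / eta: as u . w = 1 - u . (u - w), it suffices that
   u . (u - w) <= q, and this holds because the off-diagonal block of E is at
   most (v . E v) / sqrt 3, so that the part of u . (u - w) along v is at most
   |u - w| / 2.  This is only needed when the claimed bound is below 1, which forces
   3 s^2 <= q (1 - q). *)
Require Import Defs.
From mathcomp Require Import all_boot all_order all_algebra.
From mathcomp Require Import ring lra.
From mathcomp Require Import all_classical all_reals all_analysis.
Import Order.TTheory GRing.Theory Num.Theory.
Import numFieldNormedType.Exports.
Local Open Scope classical_set_scope.
Local Open Scope ring_scope.

Set Implicit Arguments.
Unset Strict Implicit.

(** * Euclidean dot product and Cauchy-Schwarz for semidefinite forms *)

Section DotProduct.
Context {R : realType} {n : nat}.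
Implicit Types (x y z : 'cV[R]_n) (G M : 'M[R]_n).

Definition dot x y : R := (x^T *m y) 0 0.

Lemma dot_sum x y : dot x y = \sum_i x i 0 * y i 0.
Proof. by rewrite /dot mxE; apply: eq_bigr => i _; rewrite mxE. Qed.

Lemma dotC x y : dot x y = dot y x.
Proof. by rewrite !dot_sum; apply: eq_bigr => i _; rewrite mulrC. Qed.

Lemma dotDr x y z : dot x (y + z) = dot x y + dot x z.
Proof. by rewrite /dot mulmxDr mxE. Qed.

Lemma dotNr x y : dot x (- y) = - dot x y.
Proof. by rewrite /dot mulmxN mxE. Qed.

Lemma dotZr a x y : dot x (a *: y) = a * dot x y.
Proof. by rewrite /dot -scalemxAr mxE. Qed.

Lemma dotDl x y z : dot (x + y) z = dot x z + dot y z.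
Proof. by rewrite ![dot _ z]dotC dotDr. Qed.

Lemma dotNl x y : dot (- x) y = - dot x y.
Proof. by rewrite ![dot _ y]dotC dotNr. Qed.

Lemma dotZl a x y : dot (a *: x) y = a * dot x y.
Proof. by rewrite ![dot _ y]dotC dotZr. Qed.

Definition dot_linear := (dotDl, dotDr, dotNl, dotNr, dotZl, dotZr).

Lemma dot_mulmx M x y : dot x (M *m y) = dot (M^T *m x) y.
Proof. by rewrite /dot trmx_mul trmxK mulmxA. Qed.

Lemma dot_scalarB c M x y : dot x ((c%:M - M) *m y) = c * dot x y - dot x (M *m y).
Proof. by rewrite mulmxBl mul_scalar_mx dotDr dotNr dotZr. Qed.

Lemma dot_Bscalar c M x y : dot x ((M - c%:M) *m y) = dot x (M *m y) - c * dot x y.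
Proof. by rewrite mulmxBl mul_scalar_mx dotDr dotNr dotZr. Qed.

Lemma dot_sym M x y : M^T = M -> dot x (M *m y) = dot y (M *m x).
Proof. by move=> Ms; rewrite dot_mulmx Ms dotC. Qed.

Lemma dot_ge0 x : 0 <= dot x x.
Proof. by rewrite dot_sum; apply: sumr_ge0 => i _; rewrite -expr2 sqr_ge0. Qed.

Lemma dot_eq0 x : (dot x x == 0) = (x == 0).
Proof.
apply/idP/eqP => [|->]; last by rewrite /dot mulmx0 mxE.
rewrite dot_sum psumr_eq0 => [/allP xx|i _]; last by rewrite -expr2 sqr_ge0.
apply/matrixP => i j; rewrite ord1 mxE; apply/eqP.
by have := xx i (mem_index_enum _); rewrite -expr2 sqrf_eq0.
Qed.

Lemma dot_gt0 x : (0 < dot x x) = (x != 0).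
Proof. by rewrite lt_def dot_ge0 andbT dot_eq0. Qed.

Lemma psdP G : psd G <-> G^T = G /\ forall x, 0 <= dot x (G *m x).
Proof. by split=> -[Gs Gp]; split=> // x; move: (Gp x); rewrite /dot mulmxA. Qed.

Lemma psd_CauchySchwarz G x y :
  psd G -> dot x (G *m y) ^+ 2 <= dot x (G *m x) * dot y (G *m y).
Proof.
move=> /psdP[Gs Gp]; set a := dot x (G *m x); set b := dot x (G *m y).
set c := dot y (G *m y).
have quad t : 0 <= a + 2 * t * b + t ^+ 2 * c.
  have := Gp (x + t *: y); rewrite mulmxDr -scalemxAr !dot_linear.
  rewrite (dot_sym y x Gs) -/a -/b -/c; lra.
have [c0|c0] := eqVneq c 0.
  have [->|b0] := eqVneq b 0; first by rewrite c0 expr0n mulr0.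
  (* The quadratic is now the affine function [a + 2 t b]; this [t] gives it the value -1. *)
  have := quad (- (a + 1) / (2 * b)); rewrite c0.
  have -> : a + 2 * (- (a + 1) / (2 * b)) * b
    + (- (a + 1) / (2 * b)) ^+ 2 * 0 = -1 by field.
  lra.
have cp : 0 < c by rewrite lt_def c0 Gp.
have := quad (- b / c).
have -> : a + 2 * (- b / c) * b + (- b / c) ^+ 2 * c = (a * c - b ^+ 2) / c.
  by field.
by rewrite pmulr_lge0 ?invr_gt0// subr_ge0.
Qed.

Lemma psd1 : psd (1%:M : 'M[R]_n).
Proof. by apply/psdP; split=> [|x]; rewrite ?tr_scalar_mx// mul1mx dot_ge0. Qed.

Lemma dot_CauchySchwarz x y : dot x y ^+ 2 <= dot x x * dot y y.
Proof. by have := psd_CauchySchwarz x y psd1; rewrite !mul1mx. Qed.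

(** Cauchy-Schwarz in the form of [G] for x and G x gives |G x|^4 <= (x, G x)(G x, G G x) <= (x, G
    x) c |G x|^2; then |G x|^2 cancels. In matrix terms, G^2 <= c G. *)
Lemma psd_dot_mulmx G c x :
  psd G -> psd (c%:M - G) -> dot (G *m x) (G *m x) <= c * dot x (G *m x).
Proof.
move=> Gpsd /psdP[_ cGp]; have CS := psd_CauchySchwarz x (G *m x) Gpsd.
have /psdP[Gs /(_ x) xGx] := Gpsd.
have cG y : dot y (G *m y) <= c * dot y y.
  by have := cGp y; rewrite dot_scalarB subr_ge0.
have [x0|x0] := eqVneq x 0; first by rewrite x0 /dot !mulmx0 !mxE mulr0.
have c0 : 0 <= c.
  by have := le_trans xGx (cG x); rewrite pmulr_lge0// dot_gt0.
have [->|Gx0] := eqVneq (dot (G *m x) (G *m x)) 0; first exact: mulr_ge0.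
have Gx : 0 < dot (G *m x) (G *m x) by rewrite lt_def Gx0 dot_ge0.
rewrite dot_mulmx Gs in CS.
rewrite -(ler_pM2r Gx) -expr2; apply: le_trans CS _.
by rewrite -mulrA mulrCA ler_wpM2l.
Qed.

End DotProduct.

(** * Scalar inequalities behind the rate and the contraction *)

Lemma tail_bound (R : realFieldType) (s q : R) :
  0 <= s -> 0 <= q -> 3 * s ^+ 2 <= q * (1 - q) -> s * (1 + q) <= 1 / 2.
Proof.
move=> s0 q0 sq; rewrite -ler_sqr ?nnegrE ?mulr_ge0 ?addr_ge0//.
have : 3 * s ^+ 2 * (1 + q) ^+ 2 <= q * (1 - q) * (1 + q) ^+ 2.
  by rewrite ler_wpM2r ?sqr_ge0.
(* These squares come from q (1 - q) (1 + q)^2 = 16/25 - 3/20 (q - 1)^2 - (q^2 + q/2 - 7/10)^2,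
   which is therefore below 3/4. *)
have := sqr_ge0 (q ^+ 2 + q / 2 - 7 / 10); have := sqr_ge0 (q - 1).
rewrite exprMn !expr2; lra.
Qed.

(** Here [s], [z], [m], [a] stand for the tail norm of u, the tail norm of w, |w| and |v . w|. With
    [X] the first term of the bound, [z <= m] suffices if [X >= 1]; otherwise [1 - q <= m] becomes
    available. *)
Lemma rate_of_bounds (R : realFieldType) (g l1 eta q s z m a mu : R) :
  0 < g -> g <= l1 -> 0 < eta -> 0 <= q -> q < 1 ->
  0 <= s -> 0 <= z -> 0 <= mu -> mu <= eta * q * s -> a <= m ->
  l1 * s = eta * q ->
  (g + eta - mu) * z <= 3 * eta * s + mu * a -> z <= m ->
  (3 * s ^+ 2 <= q * (1 - q) -> 1 - q <= m) ->
  z <= m * (3 * eta / (g * (1 - q)) * s + 2 * q * s).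
Proof.
move=> g0 gl eta0 q0 q1 s0 z0 mu0 mu_le am l1s tail zm m_ge.
have q1' : 0 < 1 - q by rewrite subr_gt0.
have m0 : 0 <= m by exact: le_trans zm.
set X := 3 * eta / (g * (1 - q)) * s.
have gX : g * (1 - q) * X = 3 * eta * s.
  by rewrite /X; field; rewrite !gt_eqF.
have X0 : 0 <= X.
  by rewrite mulr_ge0// divr_ge0 ?mulr_ge0 ?(ltW eta0) ?(ltW g0) ?(ltW q1').
have [X1|X1] := leP 1 X.
  apply: le_trans zm _; rewrite ler_peMr//.
  by apply: le_trans X1 _; rewrite lerDl !mulr_ge0.
(* That is, 3 eta s <= l1 (1 - q); multiplied by [s], with l1 s = eta q, it becomes 3 s^2 <= q (1 -
   q). *)
have gl1q : g * (1 - q) * X <= l1 * (1 - q).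
  rewrite mulrAC ler_pM2r//; apply: le_trans gl.
  by rewrite ler_piMr ?(ltW X1) ?(ltW g0).
have s_q : 3 * s ^+ 2 <= q * (1 - q).
  rewrite -(ler_pM2l eta0) expr2.
  have := ler_wpM2r s0 gl1q; rewrite gX [l1 * _ * _]mulrAC l1s; lra.
have qs : q * s <= 1 / 2 by have := tail_bound s0 q0 s_q; lra.
have {}m_ge := m_ge s_q.
(* Since mu <= eta / 2, half of eta z absorbs mu z; the remaining half accounts for the factor 2 in
   2 q s. *)
have z_le : (g + eta / 2) * z <= m * (g * X + eta * q * s).
  have : mu * z <= eta / 2 * z by rewrite ler_wpM2r//; nra.
  have : mu * a <= m * (eta * q * s) by nra.
  have : g * X * (1 - q) <= g * X * m by rewrite ler_wpM2l// mulr_ge0 ?(ltW g0).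
  lra.
have D0 : 0 < g + eta / 2 by rewrite addr_gt0 ?divr_gt0.
rewrite -(ler_pM2l D0); apply: le_trans z_le _.
rewrite [leRHS]mulrCA ler_wpM2l//.
have : 0 <= eta * X by rewrite mulr_ge0 ?(ltW eta0).
have : 0 <= g * (q * s) by rewrite !mulr_ge0 ?(ltW g0).
lra.
Qed.

(** Here [p] and [t] are the norms of w and u in the Schur form. The value of [b] makes b p^2 <= (g
    / 2) z^2, so the left side of the energy inequality is at least (1 + b) p^2, while the right
    side is at most p t (1 + q m) <= p t m (1 + 3 q) <= p t m (1 + b / 2). *)
Lemma contraction_of_bounds (R : realFieldType) (g eta b q s z p t mu a m : R) :
  0 < g -> 0 < eta -> b = g / (6 * eta) -> 0 <= q -> q <= 1 / 4 -> 6 * q <= b ->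
  0 <= s -> s <= 1 / 4 -> 0 <= z -> 0 <= p -> 0 <= t ->
  0 <= mu -> mu <= eta * q * s -> 0 <= a -> a <= m -> 1 - 4 / 3 * q <= m ->
  eta * s ^+ 2 <= t ^+ 2 -> eta * z ^+ 2 <= p ^+ 2 -> p ^+ 2 <= 3 * eta * z ^+ 2 ->
  (g - mu) * z ^+ 2 + p ^+ 2 <= p * t + mu * a * z ->
  p * (1 + b) <= m * t * (1 + b / 2).
Proof.
move=> g0 eta0 bE q0 q4 qb s0 s4 z0 p0 t0 mu0 mu_le a0 am m_ge tu pw wp energy.
have gb : g = 6 * eta * b by rewrite bE; field; rewrite gt_eqF.
have m0 : 0 <= m by exact: le_trans am.
have b0 : 0 <= b by apply: le_trans qb; rewrite mulr_ge0.
have mug : mu <= g / 2.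
  have : q * s <= b * 1 by rewrite ler_pM//; lra.
  rewrite -(ler_pM2l eta0) gb; lra.
have gz : b * p ^+ 2 <= (g - mu) * z ^+ 2.
  have : b * p ^+ 2 <= b * (3 * eta * z ^+ 2) by rewrite ler_wpM2l.
  have : g / 2 * z ^+ 2 <= (g - mu) * z ^+ 2.
    by rewrite ler_wpM2r ?sqr_ge0//; lra.
  rewrite gb; lra.
have sz : eta * s * z <= p * t.
  rewrite -ler_sqr ?nnegrE ?mulr_ge0 ?(ltW eta0)// !exprMn [leRHS]mulrC.
  have := ler_pM _ _ tu pw; rewrite !mulr_ge0 ?sqr_ge0 ?(ltW eta0)//.
  by move=> /(_ isT isT); rewrite !expr2; lra.
have muaz : mu * a * z <= q * m * (p * t).
  have : mu * (a * z) <= eta * q * s * (m * z).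
    by rewrite ler_pM ?mulr_ge0 ?ler_wpM2r.
  have : q * m * (eta * s * z) <= q * m * (p * t).
    by rewrite ler_wpM2l ?mulr_ge0.
  lra.
have [->|pN0] := eqVneq p 0.
  by rewrite mul0r !mulr_ge0 ?addr_ge0 ?divr_ge0.
rewrite -(ler_pM2l (_ : 0 < p)) ?lt_def ?pN0//.
(* (1 - 4/3 q)(1 + 2 q) = 1 + 2/3 q (1 - 4 q), at least 1 for q <= 1/4. *)
have m1 : 1 <= m * (1 + 2 * q).
  have : (1 - 4 / 3 * q) * (1 + 2 * q) <= m * (1 + 2 * q).
    by rewrite ler_wpM2r ?addr_ge0 ?mulr_ge0.
  have : q * q <= q * (1 / 4) by rewrite ler_wpM2l.
  lra.
have pt0 : 0 <= p * t by rewrite mulr_ge0.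
have : p * t * 1 <= p * t * (m * (1 + 2 * q)) by rewrite ler_wpM2l.
have : p * t * m * (6 * q) <= p * t * m * b by rewrite ler_wpM2l ?mulr_ge0.
rewrite expr2 in gz energy; lra.
Qed.

(** * Euclidean norm *)

Section Norm.
Context {R : realType} {n : nat}.
Implicit Types (x y : 'cV[R]_n).

Lemma enorm_sqrt x : enorm x = Num.sqrt (dot x x).
Proof. by rewrite dot_sum. Qed.

Lemma enorm_ge0 x : 0 <= enorm x.
Proof. exact: sqrtr_ge0. Qed.

Lemma sqr_enorm x : enorm x ^+ 2 = dot x x.
Proof. by rewrite enorm_sqrt sqr_sqrtr// dot_ge0. Qed.

Lemma enorm_eq0 x : (enorm x == 0) = (x == 0).
Proof. by rewrite -dot_eq0 -sqr_enorm sqrf_eq0. Qed.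

Lemma enorm_gt0 x : (0 < enorm x) = (x != 0).
Proof. by rewrite lt_def enorm_ge0 andbT enorm_eq0. Qed.

Lemma enormZ a x : enorm (a *: x) = `|a| * enorm x.
Proof.
by rewrite !enorm_sqrt dotZl dotZr mulrA -expr2 sqrtrM ?sqr_ge0// sqrtr_sqr.
Qed.

Lemma normr_dot_le x y : `|dot x y| <= enorm x * enorm y.
Proof.
rewrite -ler_sqr ?nnegrE ?mulr_ge0 ?enorm_ge0//.
by rewrite real_normK ?num_real// exprMn !sqr_enorm dot_CauchySchwarz.
Qed.

Lemma dot_le x y : dot x y <= enorm x * enorm y.
Proof. by apply: le_trans (normr_dot_le x y); exact: ler_norm. Qed.

Lemma enormN x : enorm (- x) = enorm x.
Proof. by rewrite -scaleN1r enormZ normrN1 mul1r. Qed.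

Lemma enorm_triangle x y : enorm (x + y) <= enorm x + enorm y.
Proof.
rewrite -ler_sqr ?nnegrE ?addr_ge0 ?enorm_ge0// sqrrD !sqr_enorm !dot_linear.
have := dot_le x y; rewrite (dotC y x); lra.
Qed.

Lemma normr_coord_le x i : `|x i 0| <= enorm x.
Proof.
rewrite -ler_sqr ?nnegrE ?enorm_ge0// real_normK ?num_real// sqr_enorm dot_sum.
by rewrite (bigD1 i)//= -expr2 lerDl sumr_ge0// => j _; rewrite -expr2 sqr_ge0.
Qed.

End Norm.

(** * Spectral gap of A on the complement of v, and the Rayleigh defect *)

Section InverseIteration.
Context {R : realType} {n : nat}.
Variables (A E : 'M[R]_n) (v : 'cV[R]_n) (l1 g eta : R).
Hypotheses (A_psd : psd A) (Av : A *m v = l1 *: v) (vv : dot v v = 1).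
Hypothesis A_gap : forall x, dot v x = 0 -> dot x (A *m x) <= (l1 - g) * dot x x.
Hypotheses (g_gt0 : 0 < g) (g_le : g <= l1) (eta_gt0 : 0 < eta).
Hypotheses (E_ge : psd (E - eta%:M)) (E_le : psd ((3 * eta)%:M - E)).
Implicit Types (x y u w : 'cV[R]_n).

Definition perp x := x - dot v x *: v.

Lemma dot_v_perp x : dot v (perp x) = 0.
Proof. by rewrite !dot_linear vv mulr1 subrr. Qed.

Lemma dot_perp x : dot (perp x) (perp x) = dot x x - dot v x ^+ 2.
Proof. by rewrite !dot_linear (dotC x v) vv; ring. Qed.

Lemma dot_split x y : dot x y = dot v x * dot v y + dot (perp x) (perp y).
Proof. by rewrite !dot_linear (dotC x v) vv; ring. Qed.

Lemma perp_le x : enorm (perp x) <= enorm x.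
Proof.
by rewrite !enorm_sqrt ler_wsqrtr// dot_perp lerBlDr lerDl sqr_ge0.
Qed.

Definition gap_mx := l1%:M - A.

Lemma gap_mx_tr : gap_mx^T = gap_mx.
Proof. by rewrite linearB/= tr_scalar_mx; case: A_psd => ->. Qed.

Lemma gap_mx_v : gap_mx *m v = 0.
Proof. by rewrite mulmxBl mul_scalar_mx Av subrr. Qed.

Lemma gap_mx_perp x : gap_mx *m perp x = gap_mx *m x.
Proof.
by rewrite mulmxBr -scalemxAr gap_mx_v scaler0 subr0.
Qed.

Lemma gap_mx_ge x : dot v x = 0 -> g * dot x x <= dot x (gap_mx *m x).
Proof.
by move=> /A_gap xA; rewrite dot_scalarB; lra.
Qed.

Lemma dot_gap_perp x : dot x (gap_mx *m x) = dot (perp x) (gap_mx *m perp x).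
Proof.
by rewrite gap_mx_perp dot_sym ?gap_mx_tr// -gap_mx_perp dot_sym ?gap_mx_tr.
Qed.

Lemma gap_mx_psd : psd gap_mx.
Proof.
apply/psdP; split=> [|x]; first exact: gap_mx_tr.
rewrite dot_gap_perp; apply: le_trans (gap_mx_ge (dot_v_perp x)).
by rewrite mulr_ge0 ?dot_ge0 ?ltW.
Qed.

(** The difference is A itself, so positivity of A is what yields mu <= l1 s^2. *)
Lemma gap_mx_le : psd (l1%:M - gap_mx).
Proof. by rewrite /gap_mx opprB addrC subrK. Qed.

(** For unit [u], the distance mu from the Rayleigh quotient to [l1]. *)
Definition defect u := l1 - dot u (A *m u).

Lemma defectE u : dot u u = 1 -> defect u = dot u (gap_mx *m u).
Proof. by move=> u1; rewrite dot_scalarB u1 mulr1. Qed.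

Lemma defect_ge0 u : dot u u = 1 -> 0 <= defect u.
Proof. by move=> /defectE->; have /psdP[_] := gap_mx_psd. Qed.

Lemma defect_le u : dot u u = 1 -> defect u <= l1 * enorm (perp u) ^+ 2.
Proof.
move=> /defectE->; have /psdP[_ /(_ (perp u))] := gap_mx_le.
by rewrite dot_scalarB -dot_gap_perp subr_ge0 sqr_enorm.
Qed.

(** Subtracting mu u projects G u off u, where G is [gap_mx], so the squared norm is |G u|^2 - mu^2;
    and |G u|^2 <= l1 mu <= l1^2 s^2. *)
Lemma residual_le u : dot u u = 1 ->
  enorm (gap_mx *m u - defect u *: u) <= l1 * enorm (perp u).
Proof.
move=> u1; have l1_ge0 : 0 <= l1 by exact: ltW (lt_le_trans g_gt0 g_le).
rewrite -ler_sqr ?nnegrE ?mulr_ge0 ?enorm_ge0// exprMn !sqr_enorm.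
have Du : dot (gap_mx *m u) (gap_mx *m u) <= l1 * defect u.
  rewrite defectE// dot_gap_perp -(gap_mx_perp u).
  exact: psd_dot_mulmx gap_mx_psd gap_mx_le.
have := defect_le u1; rewrite sqr_enorm.
set ss := dot (perp u) (perp u) => mu_le.
rewrite !dot_linear (dotC (_ *m _) u) -defectE// u1.
have : l1 * defect u <= l1 * (l1 * ss) by rewrite ler_wpM2l.
have := sqr_ge0 (defect u); rewrite expr2; lra.
Qed.

(** * The error form E: bounds, pivot, and Schur complement with respect to v *)

Lemma E_sym : E^T = E.
Proof.
case: E_ge => [+ _]; rewrite linearB/= tr_scalar_mx => /(congr1 (+%R^~ eta%:M)).
by rewrite !subrK.
Qed.

Lemma dot_E_ge x : eta * dot x x <= dot x (E *m x).
Proof.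
by have /psdP[_ /(_ x)] := E_ge; rewrite dot_Bscalar subr_ge0.
Qed.

Lemma dot_E_le x : dot x (E *m x) <= 3 * eta * dot x x.
Proof.
by have /psdP[_ /(_ x)] := E_le; rewrite dot_scalarB subr_ge0.
Qed.

Lemma E_psd : psd E.
Proof.
apply/psdP; split=> [|x]; first exact: E_sym.
by apply: le_trans (dot_E_ge x); rewrite mulr_ge0 ?dot_ge0 ?ltW.
Qed.

Definition pivot := dot v (E *m v).

Lemma pivot_ge : eta <= pivot.
Proof. by have := dot_E_ge v; rewrite vv mulr1. Qed.

Lemma pivot_gt0 : 0 < pivot.
Proof. exact: lt_le_trans pivot_ge. Qed.

(* The squared norm of the off-diagonal block of E is at most
   (pivot - eta) (3 eta - pivot), whose ratio to pivot^2 peaks at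
   pivot = 3/2 eta with value 1/3. *)
Lemma offdiag_le : 3 * dot (perp (E *m v)) (perp (E *m v)) <= pivot ^+ 2.
Proof.
have E_le' : psd ((2 * eta)%:M - (E - eta%:M)).
  rewrite opprB addrA -raddfD/=.
  by have -> : 2 * eta + eta = 3 * eta by ring.
have := psd_dot_mulmx v E_ge E_le'.
rewrite dot_perp mulmxBl mul_scalar_mx !dot_linear vv (dotC (E *m v) v) -/pivot.
have := sqr_ge0 (2 * pivot - 3 * eta); lra.
Qed.

Lemma dot_E_v_le x : dot v x = 0 ->
  Num.sqrt 3 * `|dot x (E *m v)| <= pivot * enorm x.
Proof.
move=> vx; have -> : dot x (E *m v) = dot x (perp (E *m v)).
  by rewrite dotDr dotNr dotZr (dotC x v) vx mulr0 subr0.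
apply: le_trans (_ : Num.sqrt 3 * (enorm x * enorm (perp (E *m v))) <= _).
  by rewrite ler_wpM2l ?sqrtr_ge0 ?normr_dot_le.
rewrite mulrCA mulrC ler_wpM2r ?enorm_ge0//.
rewrite -ler_sqr ?nnegrE ?mulr_ge0 ?sqrtr_ge0 ?enorm_ge0 ?(ltW pivot_gt0)//.
by rewrite exprMn sqr_sqrtr// sqr_enorm; exact: offdiag_le.
Qed.

(* schur_proj x is E-orthogonal to v, so schur is the Schur complement of E with
   respect to v, extended by zero along v. *)
Definition schur_proj x := x - (dot v (E *m x) / pivot) *: v.
Definition schur x y := dot (schur_proj x) (E *m schur_proj y).

Lemma dot_v_schur_proj x : dot v (E *m schur_proj x) = 0.
Proof.
rewrite mulmxBr -scalemxAr !dot_linear -/pivot divfK ?subrr//.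
by rewrite gt_eqF ?pivot_gt0.
Qed.

Lemma schurE x y :
  schur x y = dot x (E *m y) - dot v (E *m x) * dot v (E *m y) / pivot.
Proof.
have p0 : pivot != 0 by rewrite gt_eqF ?pivot_gt0.
rewrite /schur dotDl dotNl dotZl dot_v_schur_proj mulr0 subr0.
rewrite mulmxBr -scalemxAr !dot_linear (dot_sym x v E_sym).
by field.
Qed.

Lemma schur_ge0 x : 0 <= schur x x.
Proof. by have /psdP[_ Ep] := E_psd; exact: Ep. Qed.

Lemma schur_CauchySchwarz x y : schur x y ^+ 2 <= schur x x * schur y y.
Proof. exact: psd_CauchySchwarz E_psd. Qed.

Lemma schur_le x : schur x x <= 3 * eta * dot x x.
Proof.
apply: le_trans (dot_E_le x); rewrite schurE lerBlDr lerDl.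
by rewrite -expr2 divr_ge0 ?sqr_ge0// ltW ?pivot_gt0.
Qed.

(** For x orthogonal to v, subtracting a multiple of v only lengthens x, so the Schur complement
    inherits the lower bound of E. *)
Lemma schur_ge x : dot v x = 0 -> eta * dot x x <= schur x x.
Proof.
move=> vx; apply: le_trans (dot_E_ge _); rewrite ler_wpM2l ?(ltW eta_gt0)//.
rewrite /schur_proj !dot_linear vx (dotC x v) vx vv.
have := sqr_ge0 (dot v (E *m x) / pivot); rewrite expr2; lra.
Qed.

(** [schur_proj] kills v. *)
Lemma schur_proj_perp x : schur_proj (perp x) = schur_proj x.
Proof.
have p0 : pivot != 0 by rewrite gt_eqF ?pivot_gt0.
rewrite /schur_proj mulmxBr -scalemxAr !dot_linear -/pivot /perp -addrA -opprD.
rewrite -scalerDl mulrBl mulfK// addrCA subrr addr0 //.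
Qed.

Lemma schur_perp x y : schur (perp x) (perp y) = schur x y.
Proof. by rewrite /schur !schur_proj_perp. Qed.

(** * One unnormalized step: estimates for the solution w of (lambda(u) I - A + E) w = E u *)

Section Step.
Variables u w : 'cV[R]_n.
Hypothesis u1 : dot u u = 1.
Hypothesis step : dot u (A *m u) *: w - A *m w + E *m w = E *m u.

Let mu := defect u.
Let a := dot v w.

Lemma step_gap : gap_mx *m w - mu *: w = E *m (u - w).
Proof.
rewrite mulmxBr -step /gap_mx mulmxBl mul_scalar_mx /mu /defect.
by rewrite scalerBl addrK opprB addrC addrA subrK.
Qed.

Lemma step_v : dot v (E *m (u - w)) = - (mu * a).
Proof.
rewrite -step_gap !dot_linear dot_sym ?gap_mx_tr// gap_mx_v.
by rewrite {1}/dot mulmx0 mxE add0r.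
Qed.

(** The residual r = u - w solves (E + G - mu) r = (G - mu) u with G = [gap_mx]; test against r,
    using E >= eta and G >= 0. *)
Lemma step_residual_le :
  (eta - mu) * enorm (u - w) <= l1 * enorm (perp u).
Proof.
set r := u - w; have [->|r0] := eqVneq r 0.
  rewrite [enorm 0](_ : _ = 0) ?mulr0 ?mulr_ge0 ?enorm_ge0//.
    exact: ltW (lt_le_trans g_gt0 g_le).
  by apply/eqP; rewrite enorm_eq0.
have cancel4 (p q s t : 'cV[R]_n) : p - q + (s - p) - (t - q) = s - t.
  by rewrite addrC [p - q + _]addrC opprB !addrA subrK addrC !addrA addNr add0r addrC.
have rE : E *m r + gap_mx *m r - mu *: r = gap_mx *m u - mu *: u.
  by rewrite -step_gap mulmxBr scalerBr cancel4.
rewrite -(ler_pM2r (_ : 0 < enorm r)) ?enorm_gt0//.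
have := dot_le r (gap_mx *m u - mu *: u); rewrite -{1}rE !dotDr dotNr dotZr.
have : enorm r * enorm (gap_mx *m u - mu *: u) <= enorm r * (l1 * enorm (perp u)).
  by rewrite ler_wpM2l ?enorm_ge0// residual_le.
have := dot_E_ge r; have /psdP[_ /(_ r)] := gap_mx_psd.
rewrite -sqr_enorm expr2; lra.
Qed.

(** Test [step_gap] against z = [perp w]. The right side (z, E (u - w)) splits into its Schur part
    and a pivot part, and [step_v] evaluates the latter. *)
Lemma step_energy :
  (g - mu) * dot (perp w) (perp w) + schur w w <=
  schur w u + - (mu * a) * (dot (perp w) (E *m v) / pivot).
Proof.
set z := perp w; have vz : dot v z = 0 by exact: dot_v_perp.
have zz : dot z w = dot z z by rewrite [in RHS]/z dotDr dotNr dotZr (dotC z v) vz; ring.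
have := congr1 (dot z) step_gap; rewrite dotDr dotNr dotZr zz.
rewrite -(gap_mx_perp w) -/z => zstep.
have := gap_mx_ge vz => zgap.
have : dot z (E *m (u - w)) = schur z (u - w) + - (mu * a) * (dot z (E *m v) / pivot).
  by rewrite schurE step_v (dot_sym v z E_sym); ring.
have schurB x : schur x (u - w) = schur x u - schur x w.
  by rewrite !schurE mulmxBr !dot_linear; ring.
have -> : schur z (u - w) = schur w (u - w) by rewrite /schur schur_proj_perp.
rewrite schurB; lra.
Qed.

(** The cross term is bounded by [dot_E_v_le], whose factor sqrt 3 is weakened to 1. *)
Lemma step_schur :
  (g - mu) * enorm (perp w) ^+ 2 + schur w w <=
  schur w u + mu * `|a| * enorm (perp w).
Proof.
rewrite sqr_enorm; apply: le_trans step_energy _; rewrite lerD2l.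
have mu0 : 0 <= mu by exact: defect_ge0.
have f_le : `|dot (perp w) (E *m v) / pivot| <= enorm (perp w).
  rewrite normrM normfV (gtr0_norm pivot_gt0) ler_pdivrMr ?pivot_gt0// mulrC.
  apply: le_trans (dot_E_v_le (dot_v_perp w)); rewrite ler_peMl//.
  by rewrite -[X in X <= _]sqrtr1 ler_wsqrtr// ler1n.
apply: le_trans (ler_norm _) _; rewrite normrM normrN normrM (ger0_norm mu0).
by rewrite ler_wpM2l// mulr_ge0.
Qed.

(** Both Schur terms of [step_schur] are replaced by Euclidean ones, through eta <= S <= 3 eta, and
    the tail norm of w is cancelled. *)
Lemma step_tail_le :
  (g + eta - mu) * enorm (perp w) <= 3 * eta * enorm (perp u) + mu * `|a|.
Proof.
have mu0 : 0 <= mu by exact: defect_ge0.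
have wu_le : schur w u <= 3 * eta * enorm (perp w) * enorm (perp u).
  apply: le_trans (ler_norm _) _.
  rewrite -ler_sqr ?nnegrE ?mulr_ge0 ?enorm_ge0 ?(ltW eta_gt0)//.
  rewrite real_normK ?num_real//; apply: le_trans (schur_CauchySchwarz w u) _.
  rewrite -(schur_perp w w) -(schur_perp u u).
  apply: le_trans (ler_pM (schur_ge0 _) (schur_ge0 _) (schur_le _) (schur_le _)) _.
  by rewrite -!sqr_enorm !exprMn le_eqVlt; apply/orP; left; apply/eqP; ring.
have := schur_ge (dot_v_perp w); rewrite schur_perp -sqr_enorm => ww_ge.
have [Z0|Z0] := eqVneq (enorm (perp w)) 0.
  by rewrite Z0 mulr0 addr_ge0 ?mulr_ge0 ?enorm_ge0 ?(ltW eta_gt0).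
rewrite -(ler_pM2r (_ : 0 < enorm (perp w))); last first.
  by rewrite lt_def Z0 enorm_ge0.
have := step_schur; rewrite expr2; rewrite expr2 in ww_ge; lra.
Qed.

Lemma dot_u_step : dot u w = 1 - dot u (u - w).
Proof. by rewrite dotDr dotNr u1; ring. Qed.

Lemma pivot_residual :
  dot v (u - w) * pivot + dot (perp (u - w)) (E *m v) = - (mu * a).
Proof.
set r := u - w; have -> : - (mu * a) = dot v (E *m (perp r + dot v r *: v)).
  by rewrite subrK step_v.
rewrite mulmxDr -scalemxAr [RHS]dotDr dotZr -/pivot (dot_sym v _ E_sym) addrC.
by [].
Qed.

Lemma enorm_unit : enorm u = 1.
Proof. by rewrite enorm_sqrt u1 sqrtr1. Qed.

Lemma normr_dot_v_le x : `|dot v x| <= enorm x.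
Proof. by have := normr_dot_le v x; rewrite [enorm v]enorm_sqrt vv sqrtr1 mul1r. Qed.

Lemma defect_le_tail q : l1 * enorm (perp u) = eta * q ->
  mu <= eta * q * enorm (perp u).
Proof. by move=> <-; rewrite -mulrA -expr2; exact: defect_le. Qed.

Lemma residual_norm_le q : l1 * enorm (perp u) = eta * q ->
  enorm (u - w) * (1 - q * enorm (perp u)) <= q.
Proof.
move=> l1s; have := step_residual_le; rewrite l1s.
have : mu * enorm (u - w) <= eta * q * enorm (perp u) * enorm (u - w).
  by rewrite ler_wpM2r ?enorm_ge0 ?defect_le_tail.
rewrite -[_ <= q](ler_pM2l eta_gt0); lra.
Qed.

(** With r = u - w, |w| >= u . w = 1 - u . r, so it is enough that u . r <= q. Along v this product
    contributes [c * b]; the tails contribute at most [s * d]. *)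
Lemma norm_ge_of_tail q : l1 * enorm (perp u) = eta * q ->
  q < 1 -> 3 * enorm (perp u) ^+ 2 <= q * (1 - q) -> 1 - q <= enorm w.
Proof.
have := enorm_ge0 (perp u); set s := enorm (perp u) => s0 l1s q1 sq.
have l1_gt0 : 0 < l1 by exact: lt_le_trans g_le.
have q0 : 0 <= q by rewrite -(pmulr_rge0 _ eta_gt0) -l1s mulr_ge0 ?(ltW l1_gt0).
have uN := enorm_unit.
set r := u - w; set N := enorm r.
have N0 : 0 <= N by exact: enorm_ge0.
have s_q : s * (1 + q) <= 1 / 2 by exact: tail_bound.
have s2 : s ^+ 2 <= 1 / 12.
  by have := sqr_ge0 (q - 1 / 2); rewrite expr2; lra.
have s3 : s <= 3 / 10.
  by rewrite -ler_sqr ?nnegrE//; apply: le_trans s2 _; lra.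
have N_le : N * (1 - q * s) <= q by exact: residual_norm_le.
have c2 : dot v u ^+ 2 = 1 - s ^+ 2 by rewrite /s sqr_enorm dot_perp u1; ring.
set c := dot v u in c2 *; set b := dot v r; set d := enorm (perp r).
have d0 : 0 <= d by exact: enorm_ge0.
have NE : N ^+ 2 = b ^+ 2 + d ^+ 2 by rewrite /N /d !sqr_enorm dot_perp /b; ring.
have bE : b = c - a by rewrite /b /r dotDr dotNr.
have rf : Num.sqrt 3 * `|dot (perp r) (E *m v)| <= pivot * d.
  exact: dot_E_v_le (dot_v_perp r).
have rel := pivot_residual; rewrite -/r -/b in rel.
set F := dot (perp r) (E *m v) in rf rel.
set k : R := Num.sqrt 3 in rf.
have k2 : k ^+ 2 = 3 by rewrite sqr_sqrtr.
have k0 : 0 < k by rewrite sqrtr_gt0.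
have p0 := pivot_gt0.
have mu0 : 0 <= mu by exact: defect_ge0.
have rel' : b * pivot = - (mu * a) - F by rewrite -rel addrK.
have c1 : `|c| <= 1.
  rewrite -ler_sqr ?nnegrE// real_normK ?num_real// c2 expr1n.
  by rewrite lerBlDr lerDl sqr_ge0.
have d_N : d <= N by rewrite -ler_sqr ?nnegrE// NE lerDr sqr_ge0.
(* If v . u and v . w do not have opposite signs, the mu term in [rel'] can only lower [c * b],
   which is then governed by the off-diagonal block. *)
have [ca|ca] := leP 0 (c * a).
  have cb : k * (c * b) <= d.
    have : k * `|c * F| <= pivot * d.
      apply: le_trans rf; rewrite normrM mulrCA ler_piMl//.
      by rewrite mulr_ge0 ?(ltW k0).
    have : c * b * pivot <= `|c * F|.
      have -> : c * b * pivot = - (mu * (c * a)) - c * F by rewrite -mulrA rel'; ring.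
      have := ler_norm (- (c * F)); rewrite normrN.
      have : 0 <= mu * (c * a) by exact: mulr_ge0.
      lra.
    rewrite -(ler_pM2l k0) => cbp cF; rewrite -(ler_pM2l p0); lra.
  (* 3 (c b)^2 <= d^2 and (c b)^2 <= b^2 add up to 4 (c b)^2 <= N^2. *)
  have cb_N : c * b <= N / 2.
    have [cb0|cb0] := leP (c * b) 0; first by rewrite (le_trans cb0)// divr_ge0.
    have : (k * (c * b)) ^+ 2 <= d ^+ 2.
      by rewrite ler_sqr ?nnegrE// mulr_ge0 ?(ltW k0) ?(ltW cb0).
    rewrite exprMn k2 => cb2.
    have cbb : (c * b) ^+ 2 <= b ^+ 2.
      by rewrite exprMn ler_piMl ?sqr_ge0// c2 lerBlDr lerDl sqr_ge0//.
    rewrite -ler_sqr ?nnegrE ?divr_ge0 ?(ltW cb0)// [X in _ <= X]exprMn NE; lra.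
  (* Then u . r <= N / 2 + s N <= N (1 - q s) <= q, the middle step by s (1 + q) <= 1/2. *)
  have ur : dot u r <= c * b + s * d.
    rewrite dot_split lerD2l; exact: dot_le.
  have uw : dot u w <= enorm w by have := dot_le u w; rewrite uN mul1r.
  rewrite dot_u_step -/r in uw.
  have : s * d <= s * N by rewrite ler_wpM2l.
  have : N * (s * (1 + q)) <= N * (1 / 2) by rewrite ler_wpM2l.
  lra.
(* Opposite signs would force d >= 11/12 sqrt 3, against d <= N <= 10/7: the squares are 121/48 and
   100/49. *)
exfalso.
have mu_p : mu <= pivot.
  apply: le_trans pivot_ge; apply: le_trans (defect_le u1) _.
  rewrite -/s expr2 mulrA l1s -mulrA ger_pMr//; nra.
have c2F : pivot * c ^+ 2 <= `|c| * `|F|.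
  have -> : pivot * c ^+ 2 = (pivot - mu) * (c * a) - c * F.
    transitivity (c * (b * pivot) + pivot * (c * a)); first by rewrite bE; ring.
    by rewrite rel'; ring.
  have := ler_norm (- (c * F)); rewrite normrN -normrM.
  have : (pivot - mu) * (c * a) <= 0 by rewrite mulr_ge0_le0 ?subr_ge0 ?(ltW ca).
  lra.
have kd : k * (11 / 12) <= d.
  rewrite -(ler_pM2l p0).
  have : k * (pivot * c ^+ 2) <= pivot * d.
    apply: le_trans rf; rewrite ler_pM2l//; apply: le_trans c2F _.
    by rewrite ler_piMl.
  have : k * pivot * (11 / 12) <= k * pivot * c ^+ 2.
    by rewrite ler_pM2l ?mulr_gt0// c2; lra.
  lra.
have N_10 : N <= 10 / 7 by nra.
have : (k * (11 / 12)) ^+ 2 <= (10 / 7) ^+ 2.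
  by rewrite ler_sqr ?nnegrE ?mulr_ge0 ?(ltW k0)// (le_trans kd)// (le_trans d_N).
by rewrite exprMn k2; lra.
Qed.

Lemma step_rate q : l1 * enorm (perp u) = eta * q -> q < 1 ->
  enorm (perp w) <=
  enorm w * (3 * eta / (g * (1 - q)) * enorm (perp u) + 2 * q * enorm (perp u)).
Proof.
move=> l1s q1; have s0 := enorm_ge0 (perp u).
have l1_gt0 : 0 < l1 by exact: lt_le_trans g_le.
have q0 : 0 <= q.
  by rewrite -(pmulr_rge0 _ eta_gt0) -l1s mulr_ge0 ?(ltW l1_gt0).
have z0 := enorm_ge0 (perp w).
have := norm_ge_of_tail l1s q1; have := perp_le w; have := step_tail_le.
have a_le : `|a| <= enorm w by exact: normr_dot_v_le.
have mu0 : 0 <= mu by exact: defect_ge0.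
have mu_le := defect_le_tail l1s.
move: s0 z0 mu0 mu_le a_le l1s; rewrite -/mu.
move: (enorm (perp u)) (enorm (perp w)) (enorm w) (`|a|) mu => s z m al mu'.
exact: rate_of_bounds.
Qed.

(** Besides the contraction in the Schur norm, the sign of the v-component is preserved; this
    decides between v and -v in the limit. *)
Lemma step_contract q b : l1 * enorm (perp u) = eta * q -> b = g / (6 * eta) ->
  q <= 1 / 4 -> enorm (perp u) <= 1 / 4 -> 6 * q <= b ->
  [/\ 0 < enorm w, 0 < dot v u * dot v w &
   Num.sqrt (schur w w) * (1 + b) <=
   enorm w * Num.sqrt (schur u u) * (1 + b / 2)].
Proof.
move=> l1s bE q4 s4 qb; have s0 := enorm_ge0 (perp u).
have l1_gt0 : 0 < l1 by exact: lt_le_trans g_le.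
have q0 : 0 <= q.
  by rewrite -(pmulr_rge0 _ eta_gt0) -l1s mulr_ge0 ?(ltW l1_gt0).
have z0 := enorm_ge0 (perp w).
have N0 := enorm_ge0 (u - w).
have N_le : enorm (u - w) <= 4 / 3 * q.
  have qs : q * enorm (perp u) <= 1 / 4 * (1 / 4) by rewrite ler_pM.
  have := residual_norm_le l1s; have := ler_wpM2l N0 qs; lra.
have uw : `|dot u (u - w)| <= enorm (u - w).
  by have := normr_dot_le u (u - w); rewrite enorm_unit mul1r.
have m_ge : 1 - 4 / 3 * q <= enorm w.
  have := dot_le u w; rewrite enorm_unit mul1r dot_u_step => duw.
  by move: uw; rewrite ler_norml => /andP[_]; lra.
have m_le : enorm w <= 4 / 3.
  have := enorm_triangle u (w - u); rewrite addrC subrK enorm_unit.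
  by rewrite -opprB enormN; lra.
split.
- by apply: lt_le_trans m_ge; lra.
(* The product is u . w minus the dot product of the tails, at least 1 - 1/3 - 1/3. *)
- have := dot_u_step; rewrite dot_split => cE.
  have := dot_le (perp u) (perp w).
  have := perp_le w => zm.
  have : enorm (perp u) * enorm (perp w) <= 1 / 4 * (4 / 3).
    by rewrite ler_pM// (le_trans zm).
  by move: uw; rewrite ler_norml => /andP[_]; lra.
have mu0 : 0 <= mu by exact: defect_ge0.
have mu_le := defect_le_tail l1s.
have := step_schur.
set p := Num.sqrt (schur w w); set t := Num.sqrt (schur u u).
have p2 : p ^+ 2 = schur w w by rewrite sqr_sqrtr ?schur_ge0.
have t2 : t ^+ 2 = schur u u by rewrite sqr_sqrtr ?schur_ge0.
have p0 : 0 <= p by exact: sqrtr_ge0.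
have t0 : 0 <= t by exact: sqrtr_ge0.
have wu : schur w u <= p * t.
  apply: le_trans (ler_norm _) _.
  rewrite -ler_sqr ?nnegrE ?mulr_ge0// real_normK ?num_real// exprMn p2 t2.
  exact: schur_CauchySchwarz.
move=> energy.
have := schur_le (perp w); have := schur_ge (dot_v_perp w).
have := schur_ge (dot_v_perp u); rewrite !schur_perp -!sqr_enorm -p2 -t2.
move=> tu pw wp.
apply: (contraction_of_bounds g_gt0 eta_gt0 bE q0 q4 qb s0 s4 z0 p0 t0 mu0 mu_le
  (normr_ge0 a) (normr_dot_v_le w) m_ge tu pw wp).
by rewrite p2; apply: le_trans energy _; rewrite lerD2r.
Qed.

End Step.
End InverseIteration.

(** * The normalized iteration: well-definedness, rate, and decay of the tails *)

Lemma sgr_eq_of_mul (R : realDomainType) (x y : R) : 0 < x * y -> Num.sg x = Num.sg y.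
Proof.
move=> xy; have := gtr0_sg xy; rewrite sgrM.
have y0 : y != 0 by apply: contraTneq xy => ->; rewrite mulr0 ltxx.
have sy : Num.sg y * Num.sg y = 1 by rewrite -expr2 sqr_sg y0.
by move=> /(congr1 ( *%R^~ (Num.sg y))); rewrite -mulrA sy mulr1 mul1r.
Qed.

Section EPSI.
Context {R : realType} {n : nat}.
Variables (A Ahat : 'M[R]_n) (v : 'cV[R]_n) (l1 g eta : R).
Let E := A - Ahat.
Hypotheses (A_psd : psd A) (Av : A *m v = l1 *: v) (vv : dot v v = 1).
Hypothesis A_gap : forall x, dot v x = 0 -> dot x (A *m x) <= (l1 - g) * dot x x.
Hypotheses (g_gt0 : 0 < g) (g_le : g <= l1) (eta_gt0 : 0 < eta).
Hypotheses (E_ge : psd (E - eta%:M)) (E_le : psd ((3 * eta)%:M - E)).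
Implicit Types (x u : 'cV[R]_n).

Let l1_gt0 : 0 < l1. Proof. exact: lt_le_trans g_le. Qed.

Lemma perpZ a x : perp v (a *: x) = a *: perp v x.
Proof. by rewrite /perp dotZr scalerBr scalerA. Qed.

Lemma sqrt_schurZ a x :
  Num.sqrt (schur E v (a *: x) (a *: x)) = `|a| * Num.sqrt (schur E v x x).
Proof.
rewrite !(schurE vv eta_gt0 E_ge) -!scalemxAr !dot_linear -sqrtr_sqr -sqrtrM ?sqr_ge0//.
by congr (Num.sqrt _); ring.
Qed.

Lemma tail_le_sqrt_schur u r : 0 <= r ->
  Num.sqrt (schur E v u u) <= Num.sqrt eta * r -> enorm (perp v u) <= r.
Proof.
move=> r0 ur; rewrite -(ler_pM2l (_ : 0 < Num.sqrt eta)) ?sqrtr_gt0//.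
apply: le_trans ur; rewrite enorm_sqrt -sqrtrM ?(ltW eta_gt0)// ler_wsqrtr//.
rewrite -(schur_perp vv eta_gt0 E_ge).
exact (schur_ge vv eta_gt0 E_ge (dot_v_perp vv u)).
Qed.

(** The upper bound 3 eta on the Schur form, rounded up to 4 eta. *)
Lemma sqrt_schur_le_tail u :
  Num.sqrt (schur E v u u) <= Num.sqrt eta * (2 * enorm (perp v u)).
Proof.
rewrite -ler_sqr ?nnegrE ?mulr_ge0 ?sqrtr_ge0 ?enorm_ge0//.
have S0 : 0 <= schur E v u u by exact: (schur_ge0 v eta_gt0 E_ge).
rewrite !exprMn sqr_enorm (sqr_sqrtr S0) (sqr_sqrtr (ltW eta_gt0)).
rewrite -(schur_perp vv eta_gt0 E_ge).
apply: le_trans (schur_le vv eta_gt0 E_ge E_le (perp v u)) _.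
have : 0 <= eta * dot (perp v u) (perp v u) by rewrite mulr_ge0 ?dot_ge0 ?(ltW eta_gt0).
rewrite expr2; lra.
Qed.

Section Direction.
Variable u : 'cV[R]_n.
Hypotheses (u1 : enorm u = 1) (tail_lt : l1 * enorm (perp v u) < eta).

Let uu : dot u u = 1. Proof. by rewrite -sqr_enorm u1 expr1n. Qed.

Lemma rayleigh_unit : rayleigh A u = dot u (A *m u).
Proof. by rewrite /rayleigh -mulmxA -!/(dot _ _) uu divr1. Qed.

Lemma defect_lt : defect A l1 u < eta.
Proof.
apply: le_lt_trans (defect_le A_psd Av uu) _.
apply: le_lt_trans tail_lt; rewrite ler_pM2l// expr2 ler_piMr ?enorm_ge0//.
by rewrite -u1 perp_le.
Qed.

(** The negated shifted matrix is (l1 I - A) + E - mu I, with l1 I - A >= 0 and E >= eta I. *)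
Lemma shifted_ge x :
  (eta - defect A l1 u) * dot x x <= - dot x (shifted A Ahat u *m x).
Proof.
rewrite /shifted rayleigh_unit dot_Bscalar.
have := dot_E_ge E_ge x; have /psdP[_ /(_ x)] := gap_mx_psd A_psd Av vv A_gap g_gt0.
rewrite dot_scalarB /E mulmxBl dotDr dotNr /defect; lra.
Qed.

Lemma shifted_unit : Ahat^T = Ahat -> shifted A Ahat u \in unitmx.
Proof.
move=> Ahat_sym.
have shT : (shifted A Ahat u)^T = shifted A Ahat u.
  by rewrite /shifted linearB/= Ahat_sym tr_scalar_mx.
(* [kermx] is the left kernel; symmetry of the shifted matrix turns its row vectors into columns of
   the right kernel. *)
rewrite -row_free_unit -kermx_eq0; apply/rowV0P => x /sub_kermxP xM.
apply/eqP; rewrite -trmx_eq0 -dot_eq0 eq_le dot_ge0 andbT.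
have := shifted_ge x^T; have -> : shifted A Ahat u *m x^T = 0.
  by rewrite -{1}shT -trmx_mul xM trmx0.
by rewrite {2}/dot mulmx0 mxE oppr0 pmulr_rle0// subr_gt0 defect_lt.
Qed.

Lemma epsi_dir_step : shifted A Ahat u \in unitmx ->
  dot u (A *m u) *: epsi_dir A Ahat u - A *m epsi_dir A Ahat u
    + E *m epsi_dir A Ahat u = E *m u.
Proof.
move=> unitS; have := mulKVmx unitS ((Ahat - A) *m u).
rewrite -/(epsi_dir A Ahat u); set w := epsi_dir A Ahat u.
rewrite /shifted rayleigh_unit (mulmxBl _ _ w) mul_scalar_mx => Sw.
have -> : E *m u = - ((Ahat - A) *m u) by rewrite -mulNmx opprB.
by rewrite -Sw opprB /E mulmxBl addrA subrK.
Qed.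

Lemma epsi_dir_neq0 : shifted A Ahat u \in unitmx -> epsi_dir A Ahat u != 0.
Proof.
move=> /epsi_dir_step; apply: contra_eq_neq => ->.
rewrite !mulmx0 scaler0 addr0 subr0 eq_sym; apply/eqP => Eu.
have := dot_E_ge E_ge u; rewrite Eu {2}/dot mulmx0 mxE uu mulr1.
by rewrite leNgt eta_gt0.
Qed.

Lemma epsi_step_unit : enorm (epsi_dir A Ahat u) != 0 ->
  enorm (epsi_step A Ahat u) = 1.
Proof.
by move=> d0; rewrite enormZ normfV ger0_norm ?enorm_ge0// mulVf.
Qed.

Lemma epsi_welldef : Ahat^T = Ahat -> epsi_well_defined A Ahat u.
Proof.
by move=> /shifted_unit unitS; split=> //; rewrite enorm_eq0 epsi_dir_neq0.
Qed.

Lemma epsi_step_rate q : Ahat^T = Ahat -> l1 * enorm (perp v u) = eta * q ->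
  enorm (perp v (epsi_step A Ahat u)) <=
  3 * eta / (g * (1 - q)) * enorm (perp v u) + 2 * q * enorm (perp v u).
Proof.
move=> Ahat_sym l1s; have [unitS d0] := epsi_welldef Ahat_sym.
rewrite /epsi_step perpZ enormZ normfV ger0_norm ?enorm_ge0//.
rewrite ler_pdivrMl ?lt_def ?d0 ?enorm_ge0//.
apply: (step_rate A_psd Av vv A_gap g_gt0 g_le eta_gt0 E_ge E_le uu) => //.
  exact: epsi_dir_step.
by rewrite -(ltr_pM2l eta_gt0) -l1s mulr1.
Qed.

Lemma epsi_step_contract q b : Ahat^T = Ahat ->
  l1 * enorm (perp v u) = eta * q -> b = g / (6 * eta) ->
  q <= 1 / 4 -> enorm (perp v u) <= 1 / 4 -> 6 * q <= b ->
  0 < dot v u * dot v (epsi_step A Ahat u) /\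
  let u' := epsi_step A Ahat u in
  Num.sqrt (schur E v u' u') * (1 + b) <=
  Num.sqrt (schur E v u u) * (1 + b / 2).
Proof.
move=> Ahat_sym l1s bE q4 s4 qb; have [unitS _] := epsi_welldef Ahat_sym.
have [w0 vw contr] := step_contract A_psd Av vv A_gap g_gt0 g_le eta_gt0 E_ge
  E_le uu (epsi_dir_step unitS) l1s bE q4 s4 qb.
rewrite /epsi_step; split; first by rewrite dotZr mulrCA mulr_gt0 ?invr_gt0.
rewrite /= sqrt_schurZ normfV (gtr0_norm w0) -mulrA ler_pdivrMl// mulrA.
exact: contr.
Qed.

End Direction.

(** With c = v . u the squared distance is 2 - 2 |c|, at most 4 (1 - c^2) because c^2 <= |c| <=
    1. *)
Lemma enorm_sub_sg u : enorm u = 1 -> dot v u != 0 ->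
  enorm (Num.sg (dot v u) *: v - u) <= 2 * enorm (perp v u).
Proof.
move=> u1 c0; have uu : dot u u = 1 by rewrite -sqr_enorm u1 expr1n.
rewrite -ler_sqr ?nnegrE ?mulr_ge0 ?enorm_ge0// exprMn !sqr_enorm.
rewrite (dot_perp vv) !dot_linear uu vv (dotC u v).
have c1 : `|dot v u| <= 1 by rewrite -u1 (normr_dot_v_le vv).
have sgc : Num.sg (dot v u) * dot v u = `|dot v u|.
  by rewrite -normrEsg.
have sg2 : Num.sg (dot v u) * Num.sg (dot v u) = 1.
  by rewrite -expr2 sqr_sg c0.
have c2 : dot v u ^+ 2 = `|dot v u| * `|dot v u|.
  by rewrite -expr2 real_normK ?num_real.
rewrite mulr1 sg2 sgc c2.
have : `|dot v u| * `|dot v u| <= 1 * `|dot v u| by rewrite ler_wpM2r.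
rewrite expr2; lra.
Qed.

Lemma epsi_iterates (u : nat -> 'cV[R]_n) q b sigma : Ahat^T = Ahat ->
  b = g / (6 * eta) -> 0 <= sigma -> l1 * sigma = eta * q ->
  q <= 1 / 4 -> sigma <= 1 / 4 -> 6 * q <= b ->
  enorm (u 0%N) = 1 -> epsi_sequence A Ahat u ->
  2 * enorm (perp v (u 0%N)) <= sigma ->
  forall k, [/\ enorm (u k) = 1,
    Num.sg (dot v (u k)) = Num.sg (dot v (u 0%N)), dot v (u k) != 0 &
    enorm (perp v (u k)) <= sigma * ((1 + b / 2) / (1 + b)) ^+ k].
Proof.
move=> Ahat_sym bE sig0 l1sig q4 sig4 qb u01 useq s0_le.
set th := (1 + b / 2) / (1 + b).
have b0 : 0 < b by rewrite bE divr_gt0 ?mulr_gt0.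
have th01 : 0 <= th <= 1.
  rewrite divr_ge0 ?addr_ge0 ?divr_ge0 ?(ltW b0)//=.
  by rewrite ler_pdivrMr ?addr_gt0// mul1r lerD2l; lra.
have [th0 th1] := andP th01.
have tail_le k : Num.sqrt (schur E v (u k) (u k)) <= Num.sqrt eta * (sigma * th ^+ k)
    -> enorm (perp v (u k)) <= sigma * th ^+ k.
  by apply: tail_le_sqrt_schur; rewrite mulr_ge0 ?exprn_ge0.
(* The induction runs in the Schur norm, where each step contracts; the factor 2 in the initial
   condition pays for passing to that norm. *)
suff H k : [/\ enorm (u k) = 1,
    Num.sg (dot v (u k)) = Num.sg (dot v (u 0%N)), dot v (u k) != 0 &
    Num.sqrt (schur E v (u k) (u k)) <= Num.sqrt eta * (sigma * th ^+ k)].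
  by move=> k; have [? ? ? /tail_le] := H k.
elim: k => [|k [uk1 sgk ck uk]].
  split=> //.
    apply/eqP => c0; have := dot_perp vv (u 0%N).
    rewrite c0 -!sqr_enorm u01 expr0n subr0 expr1n => s1.
    have : enorm (perp v (u 0%N)) ^+ 2 <= (1 / 4) ^+ 2.
      by rewrite ler_sqr ?nnegrE ?enorm_ge0//; have := enorm_ge0 (perp v (u 0%N)); lra.
    by rewrite s1; lra.
  apply: le_trans (sqrt_schur_le_tail _) _.
  by rewrite expr0 mulr1 ler_wpM2l ?sqrtr_ge0.
have sk : enorm (perp v (u k)) <= sigma.
  by apply: le_trans (tail_le _ uk) _; rewrite ler_piMr ?exprn_ile1.
have l1sk : l1 * enorm (perp v (u k)) <= eta * q by rewrite -l1sig ler_pM2l.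
(* The ratio of the current iterate, bounded by the uniform [q]. *)
set qk := l1 * enorm (perp v (u k)) / eta.
have qkE : l1 * enorm (perp v (u k)) = eta * qk.
  by rewrite /qk; field; rewrite gt_eqF.
have qkq : qk <= q by rewrite -(ler_pM2l eta_gt0) -qkE.
have tail_lt : l1 * enorm (perp v (u k)) < eta.
  by rewrite qkE gtr_pMr//; lra.
have [] := epsi_step_contract uk1 tail_lt Ahat_sym qkE bE _ _ _; try lra.
rewrite -useq => ck1 contr; split.
- by rewrite useq epsi_step_unit//; have [] := epsi_welldef uk1 tail_lt Ahat_sym.
- by rewrite -sgk; apply/esym/sgr_eq_of_mul.
- by apply: contraTneq ck1 => ->; rewrite mulr0 ltxx.
rewrite exprSr !mulrA ler_pdivlMr ?addr_gt0//.
apply: le_trans contr _; rewrite ler_wpM2r ?addr_ge0 ?divr_ge0 ?(ltW b0)//.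
by rewrite -mulrA.
Qed.

End EPSI.

(** * Passage to the sup-norm topology and to the coordinates of the statement *)

Lemma mx_norm_le_enorm (R : realType) (n : nat) (x : 'cV[R]_n.+1) : `|x| <= enorm x.
Proof.
rewrite [`|x|]mx_normrE; apply/bigmax_leP; split=> [|[i j] _]; first exact: enorm_ge0.
by rewrite ord1 normr_coord_le.
Qed.

Lemma cvg_enorm_geometric (R : realType) (n : nat) (u : nat -> 'cV[R]_n.+1)
    (l : 'cV[R]_n.+1) (c r : R) :
  0 <= r < 1 -> (forall k, enorm (l - u k) <= c * r ^+ k) -> u k @[k --> \oo] --> l.
Proof.
move=> /andP[r0 r1] ul; apply/cvgrPdist_lt => e e0.
have cr : geometric c r @ \oo --> 0 by apply: cvg_geometric; rewrite ger0_norm.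
near=> k; apply: le_lt_trans (mx_norm_le_enorm _) _.
apply: le_lt_trans (ul k) _; near: k; exact: (cvgr_lt 0 cr e e0).
Unshelve. all: by end_near. Qed.

Lemma dot_diag_le (R : realType) (n : nat) (d : 'rV[R]_n) (c : R) (x : 'cV[R]_n) :
  (forall i, d 0 i <= c) -> dot x (diag_mx d *m x) <= c * dot x x.
Proof.
move=> dc; rewrite !dot_sum mulr_sumr; apply: ler_sum => i _.
rewrite mul_diag_mx mxE mulrCA ler_wpM2r//.
by rewrite -expr2 sqr_ge0.
Qed.

(** V2 V2^T is the orthogonal projection I - v v^T, so the tail of the statement has the norm of
    [perp v x]. *)
Lemma enorm_trmx_perp (R : realType) (n p : nat) (v : 'cV[R]_n)
    (V2 : 'M[R]_(n, p)) (x : 'cV[R]_n) :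
  v *m v^T + V2 *m V2^T = 1%:M -> dot v v = 1 ->
  enorm (V2^T *m x) = enorm (perp v x).
Proof.
move=> VV vv; rewrite !enorm_sqrt (dot_perp vv); congr Num.sqrt.
have -> : dot (V2^T *m x) (V2^T *m x) = dot x (V2 *m V2^T *m x).
  by rewrite /dot trmx_mul trmxK !mulmxA.
have -> : V2 *m V2^T = 1%:M - v *m v^T by rewrite -VV addrAC subrr add0r.
rewrite mulmxBl mul1mx dotDr dotNr; congr (_ - _).
rewrite {1}/dot !mulmxA -mulmxA mxE big_ord1 expr2; congr (_ * _).
by rewrite -/(dot x v) dotC.
Qed.

Theorem theorem2p2 (R : realType) (n : nat)
    (A Ahat : 'M[R]_n.+2)
    (v : 'cV[R]_n.+2) (V2 : 'M[R]_(n.+2, n.+1))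
    (lam1 : R) (lam2 : 'rV[R]_n.+1) (eta : R)
    (Apsd : psd A)
    (Vorth : (row_mx v V2)^T *m row_mx v V2 = 1%:M)
    (Aeig : A = lam1 *: (v *m v^T) + V2 *m diag_mx lam2 *m V2^T)
    (lam2_decr : forall i j : 'I_n.+1, (i < j)%N -> lam2 0 j < lam2 0 i)
    (lam1_gt : lam2 0 ord0 < lam1)
    (eta_gt0 : 0 < eta)
    (Ahat_sym : Ahat^T = Ahat)
    (Ahat_col : same_column_space Ahat A)
    (Ahat_ge : loewner_le (A - (3 * eta)%:M) Ahat)
    (Ahat_le : loewner_le Ahat (A - eta%:M)) :
  (forall eps : R, 0 < eps -> lam1 / eta * eps < 1 ->
     exists2 delta : R, 0 < delta &
       forall u : nat -> 'cV[R]_n.+2,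
         enorm (u 0%N) = 1 ->
         epsi_sequence A Ahat u ->
         enorm (V2^T *m u 0%N) <= delta ->
         (forall k : nat,
            [/\ enorm (u k) = 1,
                epsi_well_defined A Ahat (u k) &
                enorm (V2^T *m u k) / enorm (u k) <= eps]) /\
         u k @[k --> \oo] --> Num.sg ((v^T *m u 0%N) 0 0) *: v)
  /\
  (forall (u : nat -> 'cV[R]_n.+2) (k : nat) (eps : R),
     epsi_sequence A Ahat u ->
     enorm (u k) = 1 ->
     enorm (V2^T *m u k) / enorm (u k) <= eps ->
     lam1 / eta * eps < 1 ->
     epsi_well_defined A Ahat (u k) /\
     enorm (V2^T *m u k.+1) <=
       3 * lam1 / (lam1 - lam2 0 ord0) * (eta / lam1)
         * (1 / (1 - lam1 / eta * eps)) * enorm (V2^T *m u k)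
       + 2 * lam1 / eta * enorm (V2^T *m u k) ^+ 2).
Proof.
(* A left inverse of a square matrix is a right inverse: v v^T + V2 V2^T = I. *)
have VV := mulmx1C Vorth; rewrite tr_row_mx mul_row_col in VV.
have := Vorth; rewrite tr_row_mx mul_col_row.
rewrite (@scalar_mx_block R 1 n.+1 1) => /eq_block_mx[vTv vTV V2Tv V2TV].
have vv : dot v v = 1 by rewrite /dot vTv mxE.
set E := A - Ahat; set g := lam1 - lam2 0 ord0.
have tail x : enorm (V2^T *m x) = enorm (perp v x) by exact: enorm_trmx_perp.
have Av : A *m v = lam1 *: v.
  rewrite Aeig mulmxDl -scalemxAl -!mulmxA vTv V2Tv !mulmx0 addr0.
  by rewrite mulmx1.
have A_tail x : dot v x = 0 ->
    dot x (A *m x) = dot (V2^T *m x) (diag_mx lam2 *m (V2^T *m x)).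
  move=> vx; have vTx : v^T *m x = 0.
    by apply/matrixP => i j; rewrite !ord1 [RHS]mxE; exact: vx.
  rewrite Aeig mulmxDl dotDr -!scalemxAl -mulmxA vTx mulmx0 scaler0.
  by rewrite {1}/dot mulmx0 mxE add0r /dot trmx_mul trmxK !mulmxA.
have A_gap x : dot v x = 0 -> dot x (A *m x) <= (lam1 - g) * dot x x.
  move=> vx; rewrite A_tail// /g opprB addrC subrK.
  have -> : dot x x = dot (V2^T *m x) (V2^T *m x).
    by rewrite -[RHS]sqr_enorm tail sqr_enorm (dot_perp vv) vx expr0n subr0.
  apply: dot_diag_le => i; have [->//|i0] := eqVneq i ord0.
  by rewrite ltW// lam2_decr// lt0n.
have g_gt0 : 0 < g by rewrite subr_gt0.
have g_le : g <= lam1.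
  (* It remains to see [lam2 0 ord0 >= 0]: test A on the first column of V2. *)
  rewrite gerBl; pose y : 'cV[R]_n.+1 := delta_mx ord0 0.
  have vx : dot v (V2 *m y) = 0 by rewrite /dot mulmxA vTV mul0mx mxE.
  have /psdP[_ /(_ (V2 *m y))] := Apsd; rewrite A_tail// mulmxA V2TV mul1mx.
  rewrite dot_sum (bigD1 ord0)//= mul_diag_mx !mxE !eqxx mul1r mulr1 big1 ?addr0//.
  by move=> i i0; rewrite /y !mxE (negbTE i0) mul0r.
have E_ge : psd (E - eta%:M).
  by move: Ahat_le; rewrite /loewner_le /E addrAC.
have E_le : psd ((3 * eta)%:M - E).
  by move: Ahat_ge; rewrite /loewner_le /E !opprB addrCA.
have lam1_gt0 : 0 < lam1 by exact: lt_le_trans g_le.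
split.
- move=> eps eps0 _; have [b bE b0] : exists2 b, b = g / (6 * eta) & 0 < b.
    by eexists; rewrite // divr_gt0 ?mulr_gt0.
  (* The four bounds ensure, in order, sigma <= 1/4, tails below eps, q <= 1/4 and 6 q <= b, for q =
     lam1 sigma / eta. *)
  pose sigma := Num.min (Num.min (1 / 4) eps)
    (Num.min (eta / (4 * lam1)) (eta * b / (6 * lam1))).
  have sig0 : 0 < sigma.
    by rewrite !lt_min eps0 andbT; apply/and3P; split; rewrite divr_gt0 ?mulr_gt0.
  have : sigma <= sigma by [].
  rewrite {2}/sigma !le_min => /andP[/andP[sig4 sig_eps] /andP[sig_q sig_b]].
  pose q := lam1 * sigma / eta.
  have qE : lam1 * sigma = eta * q by rewrite /q; field; rewrite gt_eqF.
  have q4 : q <= 1 / 4.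
    move: sig_q; rewrite ler_pdivlMr ?mulr_gt0// => sig_q.
    by rewrite -(ler_pM2l eta_gt0) -qE; lra.
  have qb : 6 * q <= b.
    move: sig_b; rewrite ler_pdivlMr ?mulr_gt0// => sig_b.
    by rewrite -(ler_pM2l eta_gt0); lra.
  exists (sigma / 2) => [|u u01 useq]; first by rewrite divr_gt0.
  rewrite tail => u0_le.
  have u0_le2 : 2 * enorm (perp v (u 0%N)) <= sigma by lra.
  have iter := epsi_iterates Apsd Av vv A_gap g_gt0 g_le eta_gt0 E_ge E_le
    Ahat_sym bE (ltW sig0) qE q4 sig4 qb u01 useq u0_le2.
  set th := (1 + b / 2) / (1 + b) in iter.
  have th0 : 0 <= th by rewrite divr_ge0 ?addr_ge0 ?divr_ge0 ?(ltW b0).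
  have th1 : th < 1 by rewrite ltr_pdivrMr ?addr_gt0// mul1r ltrD2l; lra.
  split=> [k|].
    have [uk1 _ _ sk] := iter k.
    have sk_le : enorm (perp v (u k)) <= sigma.
      by apply: le_trans sk _; rewrite ler_piMr ?exprn_ile1 ?(ltW sig0) ?(ltW th1).
    split=> //; last by rewrite uk1 divr1 tail (le_trans sk_le).
    apply: (epsi_welldef Apsd Av vv A_gap g_gt0 g_le eta_gt0 E_ge) => //.
    apply: le_lt_trans (_ : lam1 * sigma < eta); first by rewrite ler_pM2l.
    by rewrite qE gtr_pMr//; lra.
  apply: (@cvg_enorm_geometric _ _ _ _ (2 * sigma) th) => [|k].
    by rewrite th0 th1.
  have [uk1 sgk ck sk] := iter k.
  (* The sign never changes, so every iterate is compared with the same limit. *)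
  rewrite -/(dot v (u 0%N)) -sgk -mulrA.
  by apply: le_trans (enorm_sub_sg vv uk1 ck) _; rewrite ler_pM2l.
move=> u k eps useq uk1; rewrite uk1 divr1 useq !tail => sk eps1.
set s := enorm (perp v (u k)) in sk *.
have s0 : 0 <= s by exact: enorm_ge0.
pose q := lam1 / eta * s.
have qE : lam1 * s = eta * q by rewrite /q; field; rewrite gt_eqF.
have q_le : q <= lam1 / eta * eps by rewrite ler_wpM2l// divr_ge0 ?ltW.
have q1 : q < 1 by exact: le_lt_trans q_le eps1.
have tail_lt : lam1 * s < eta by rewrite qE gtr_pMr.
(* The rate is applied with the ratio [q] of the actual tail, then weakened to [Q >= q] by
   monotonicity of 1 / (1 - q). *)
move: (lam1 / eta * eps) q_le eps1 => Q q_le Q1.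
split.
  exact: (epsi_welldef Apsd Av vv A_gap g_gt0 g_le eta_gt0 E_ge uk1 tail_lt).
apply: le_trans (epsi_step_rate Apsd Av vv A_gap g_gt0 g_le eta_gt0 E_ge E_le uk1
  tail_lt Ahat_sym qE) _.
have -> : 2 * lam1 / eta * s ^+ 2 = 2 * q * s.
  by rewrite /q; field; rewrite gt_eqF.
rewrite -/s lerD2r.
rewrite ler_wpM2r// -/g.
have -> : 3 * lam1 / g * (eta / lam1) * (1 / (1 - Q))
    = 3 * eta / (g * (1 - Q)).
  by field; rewrite !gt_eqF//= ?subr_gt0.
have D0 : 0 < g * (1 - Q) by rewrite mulr_gt0 ?subr_gt0.
rewrite ler_wpM2l ?mulr_ge0 ?(ltW eta_gt0)// lef_pV2 ?posrE ?mulr_gt0 ?subr_gt0//.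
by rewrite ler_pM2l// lerD2l lerN2.
Qed.
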